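(* Let $n\ge 2$ be an integer and let $r,v,\bar b\in\mathbb{R}$ satisfy $r>1$, $0<v<\frac{r-1}{2}$, and $\bar b>\left(\frac{2v}{r-1}\right)^n$. Let $\mathbf{A}\in\mathbb{R}^{n\times n}$ be the matrix with $\mathbf{A}_{1,1}=r$, $\mathbf{A}_{j,j+1}=v$ for $1\le j\le n-1$, and all other entries zero. Let $\mathbf{B}_3=(0,0,\dots,0,v)^\top\in\mathbb{R}^n$ and $\mathbf{B}_4=(\bar b,0,\dots,0,v)^\top\in\mathbb{R}^n$ (first entry $\bar b$, last entry $v$, all others zero). Then the pair of single-input systems $S_3=(\mathbf{A},\mathbf{B}_3)$ and $S_4=(\mathbf{A},\mathbf{B}_4)$ is not co-stabilizable by any linear static state feedback controller, but it is co-stabilizable by some linear dynamic state feedback controller.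
   Context: A system $(\mathbf{A},\mathbf{B})$ with $\mathbf{A}\in\mathbb{R}^{n\times n}$, $\mathbf{B}\in\mathbb{R}^{n\times m}$ denotes the fully observed discrete-time linear time-invariant system $\mathbf{x}_{t+1}=\mathbf{A}\mathbf{x}_t+\mathbf{B}\mathbf{u}_t$; here $m=1$. $\rho(\cdot)$ denotes the spectral radius of a real square matrix. Linear static state feedback: $\mathbf{u}_t=\mathbf{K}\mathbf{x}_t$ with $\mathbf{K}\in\mathbb{R}^{m\times n}$. A pair of systems $(\mathbf{A}_i,\mathbf{B}_i)$, with $i$ ranging over two indices, is co-stabilizable by linear static state feedback if there is a single $\mathbf{K}\in\mathbb{R}^{m\times n}$ with $\rho(\mathbf{A}_i+\mathbf{B}_i\mathbf{K})<1$ for both $i$. Linear dynamic state feedback: $\mathbf{z}_{t+1}=\mathbf{F}\mathbf{z}_t+\mathbf{G}\mathbf{x}_t$, $\mathbf{u}_t=\mathbf{H}\mathbf{z}_t+\mathbf{K}\mathbf{x}_t$, where $\mathbf{z}_t\in\mathbb{R}^p$, $\mathbf{F}\in\mathbb{R}^{p\times p}$, $\mathbf{G}\in\mathbb{R}^{p\times n}$, $\mathbf{H}\in\mathbb{R}^{m\times p}$, $\mathbf{K}\in\mathbb{R}^{m\times n}$. The pair is co-stabilizable by linear dynamic state feedback if there exist an integer $p\ge 0$ and real matrices $(\mathbf{K},\mathbf{H},\mathbf{G},\mathbf{F})$ of these sizes (the same for both systems) such that $\rho\!\left(\begin{bmatrix}\mathbf{A}_i+\mathbf{B}_i\mathbf{K}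 & \mathbf{B}_i\mathbf{H}\\ \mathbf{G}&\mathbf{F}\end{bmatrix}\right)<1$ for both $i$. *)

(* Defs.v *)
From HB Require Import structures.
From mathcomp Require Import all_boot all_order all_algebra.
From mathcomp Require Import complex.
From mathcomp Require Import classical_sets reals.

Set Implicit Arguments.
Unset Strict Implicit.
Unset Printing Implicit Defensive.

Import Order.TTheory GRing.Theory Num.Theory.
Local Open Scope classical_set_scope.
Local Open Scope ring_scope.

(* The eigenvalues are the complex ones: M is first mapped into R[i].
   There are finitely many, and at least one when n > 0, so this supremum is a
   maximum; it is 0 for the empty matrix. *)
Definition spectral_radius (R : realType) (n : nat) (M : 'M[R]_n) : R :=
  sup [set x | exists2 z : R[i],
         eigenvalue (map_mx (real_complex R) M) z & x = Normc.normc z].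

(* x_{t+1} = Amx x_t + Bmx u_t, with the whole state x_t observed. *)
Record lti_system (R : realType) (n m : nat) := LTISystem {
  Amx : 'M[R]_n ;
  Bmx : 'M[R]_(n, m)
}.

(* Closed loop under u_t = K x_t. *)
Definition static_closed_loop (R : realType) (n m : nat)
    (S : lti_system R n m) (K : 'M[R]_(m, n)) : 'M[R]_n :=
  Amx S + Bmx S *m K.

(* Closed loop, acting on the stacked state (x_t, z_t), under
   z_{t+1} = F z_t + G x_t and u_t = H z_t + K x_t. *)
Definition dynamic_closed_loop (R : realType) (n m p : nat)
    (S : lti_system R n m) (K : 'M[R]_(m, n)) (H : 'M[R]_(m, p))
    (G : 'M[R]_(p, n)) (F : 'M[R]_p) : 'M[R]_(n + p) :=
  block_mx (Amx S + Bmx S *m K) (Bmx S *m H) G F.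

Definition co_stabilizable_static (R : realType) (n m : nat)
    (S1 S2 : lti_system R n m) : Prop :=
  exists K : 'M[R]_(m, n),
    spectral_radius (static_closed_loop S1 K) < 1 /\
    spectral_radius (static_closed_loop S2 K) < 1.

Definition co_stabilizable_dynamic (R : realType) (n m : nat)
    (S1 S2 : lti_system R n m) : Prop :=
  exists (p : nat) (K : 'M[R]_(m, n)) (H : 'M[R]_(m, p))
         (G : 'M[R]_(p, n)) (F : 'M[R]_p),
    spectral_radius (dynamic_closed_loop S1 K H G F) < 1 /\
    spectral_radius (dynamic_closed_loop S2 K H G F) < 1.

(* Indices in 'I_n start at 0. *)
Definition A_mx (R : realType) (n : nat) (r v : R) : 'M[R]_n :=
  \matrix_(i < n, j < n)
    if ((i : nat) == 0%N) && ((j : nat) == 0%N) then r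
    else if (j : nat) == i.+1 then v
    else 0.

Definition B3_mx (R : realType) (n : nat) (v : R) : 'M[R]_(n, 1) :=
  \col_(i < n) if i.+1 == n then v else 0.

(* For n >= 2 the first and last entries are distinct. *)
Definition B4_mx (R : realType) (n : nat) (v b : R) : 'M[R]_(n, 1) :=
  \col_(i < n)
    if (i : nat) == 0%N then b
    else if i.+1 == n then v
    else 0.

(* Main.v *)
(* Static feedback: the two closed-loop traces differ by b k_1, so that
   |b k_1| <= 2n <= 2^n when both loops are stable, while evaluating the
   characteristic polynomial of the first loop at r gives
   |k_1| v^n = prod |r - lambda| >= (r - 1)^n, which is incompatible with the
   lower bound on b.

   Dynamic feedback: for polynomials alpha and kappa in the delay 1/z, let
   u = alpha x_1 + kappa x_2 + (static feedback of x_3, ..., x_n).  The static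
   gains and kappa can be chosen so that the nonzero closed-loop eigenvalues are
   the nonzero roots of z = b_i alpha(1/z), where b_i is the first entry of the
   input vector, at the price of one interpolation condition on alpha(1/r).
   There is no such root for b_i = 0; taking b alpha(1/z) / z = 1 - (1 + a/z)^N
   makes -a the only one for b_i = b, and the interpolation condition becomes
   (1 + a/r)^N = 1 + b r^(n-1) / v^n, which has a solution a <= 1/2 as soon as
   N is large. *)

Require Import Defs.
From HB Require Import structures.
From mathcomp Require Import all_boot all_order all_algebra.
From mathcomp Require Import complex.
From mathcomp Require Import classical_sets reals.
From mathcomp Require Import ring.

Set Implicit Arguments.
Unset Strict Implicit.
Unset Printing Implicit Defensive.

Import Order.TTheory GRing.Theory Num.Theory.
Local Open Scope ring_scope.

(** * Trace and determinant bounds for matrices of spectral radius below 1 *)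

Lemma char_poly_horner (F : comNzRingType) (n : nat) (M : 'M[F]_n) (x : F) :
  (char_poly M).[x] = \det (x%:M - M).
Proof.
rewrite /char_poly -[LHS]/(horner_eval x _) -det_map_mx; congr determinant.
apply/matrixP=> i j; rewrite !mxE.
by rewrite rmorphB rmorphMn /= /horner_eval hornerX hornerC. 
Qed.

Section SpectralRadius.

Variables (R : realType) (n : nat) (M : 'M[R]_n).

Let MC := map_mx (real_complex R) M.

Lemma normr_normc (z : R[i]) : `|z| = real_complex R (Normc.normc z).
Proof. by case: z. Qed.

Lemma char_poly_normal :
  exists2 rs : seq R[i], char_poly MC = \prod_(z <- rs) ('X - z%:P) &
    size rs = n.
Proof.
have [rs] := closed_field_poly_normal (char_poly MC).
rewrite (monicP (char_poly_monic _)) scale1r => rsE; exists rs => //.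
by apply: succn_inj; rewrite -(size_prod_XsubC rs id) -rsE size_char_poly.
Qed.

Lemma eigenvalue_le_spectral_radius (z : R[i]) :
  eigenvalue MC z -> `|z| <= real_complex R (spectral_radius M).
Proof.
move=> Mz; rewrite normr_normc lecR; apply: ub_le_sup; last by exists z.
have [rs rsE _] := char_poly_normal.
(* The supremum needs an upper bound; the sum of all root moduli is one. *)
exists (\sum_(x <- rs) Normc.normc x) => _ [x Mx ->].
move: Mx; rewrite eigenvalue_root_char rsE root_prod_XsubC => x_rs.
rewrite (big_rem x) //= lerDl sumr_ge0 // => y _.
by rewrite -ler0c -normr_normc.
Qed.

Lemma spectral_radius_le (a : R) : 0 <= a ->
  (forall z, eigenvalue MC z -> `|z| <= real_complex R a) ->
  spectral_radius M <= a.
Proof.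
move=> a_ge0 Ma; rewrite /spectral_radius; set E := (X in sup X).
(* An empty spectrum has supremum 0, which is where [0 <= a] enters. *)
have [->|/set0P E0] := eqVneq E set0; first by rewrite sup0.
by apply: ge_sup => // _ [z Mz ->]; rewrite -lecR -normr_normc Ma.
Qed.

Hypothesis M1 : spectral_radius M < 1.

Let root_le1 (rs : seq R[i]) :
  char_poly MC = \prod_(z <- rs) ('X - z%:P) ->
  forall z, z \in rs -> `|z| <= 1.
Proof.
move=> rsE z z_rs.
apply: (le_trans (@eigenvalue_le_spectral_radius z _)); last first.
  by rewrite -[1]/(real_complex R 1) lecR ltW.
by rewrite eigenvalue_root_char rsE root_prod_XsubC.
Qed.

Lemma norm_mxtrace_le : `|\tr M| <= n%:R.
Proof.
have [n0|n_gt0] := posnP n.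
  by rewrite /mxtrace big1 ?normr0 // => i _; have := ltn_ord i; rewrite [X in (_ < X)%N]n0.
have [rs rsE rs_n] := char_poly_normal.
(* Both are minus the coefficient of degree n - 1 of the characteristic polynomial, which requires n
   > 0. *)
have trE : \sum_(z <- rs) z = real_complex R (\tr M).
  apply: oppr_inj; rewrite -coefPn_prod_XsubC ?rs_n -?lt0n // -rsE.
  by rewrite char_poly_trace // trace_map_mx.
have Ctr : `|real_complex R (\tr M)| = real_complex R `|\tr M|.
  by rewrite normr_normc /= expr0n addr0 sqrtr_sqr.
rewrite -lecR -Ctr -trE rmorph_nat -rs_n.
apply: le_trans (ler_norm_sum _ _ _) _.
rewrite -sum1_size natr_sum !big_seq; apply: ler_sum => z.
exact: (root_le1 rsE).
Qed.

(** The determinant is the product of the x - z over the eigenvalues z, and |x - z| >= x - |z| >= x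
    - 1. *)
Lemma norm_det_sub_ge (x : R) : 1 <= x -> (x - 1) ^+ n <= `|\det (x%:M - M)|.
Proof.
move=> x_ge1; have [rs rsE rs_n] := char_poly_normal.
have detE : real_complex R (\det (x%:M - M)) =
    \prod_(z <- rs) (real_complex R x - z).
  rewrite -char_poly_horner -horner_map map_char_poly /= rsE horner_prod.
  by apply: eq_bigr => z _; rewrite !hornerE.
have Cdet : `|real_complex R (\det (x%:M - M))| =
    real_complex R `|\det (x%:M - M)|.
  by rewrite normr_normc /= expr0n addr0 sqrtr_sqr.
rewrite -lecR -Cdet detE rmorphXn /= -rs_n.
have: forall z, z \in rs -> `|z| <= 1 by exact: root_le1.
elim: rs {rsE rs_n detE} => [|z s IHs] s_le1 /=.
  by rewrite big_nil expr0 normr1.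
rewrite big_cons normrM exprS; apply: ler_pM.
- by rewrite ler0c subr_ge0.
- by rewrite exprn_ge0 // ler0c subr_ge0.
- apply: le_trans (lerB_dist _ _); rewrite rmorphB rmorph1 lerB //.
    by rewrite normr_normc lecR /= expr0n addr0 sqrtr_sqr ler_norm.
  by rewrite s_le1 ?mem_head.
- by apply: IHs => y y_s; rewrite s_le1 // in_cons y_s orbT.
Qed.

End SpectralRadius.

(** * Impossibility of static feedback *)

Lemma mxtrace_S4_sub_S3 (R : realType) (m : nat) (r v b : R)
    (K : 'M[R]_(1, m.+2)) :
  \tr (A_mx m.+2 r v + B4_mx m.+2 v b *m K) -
    \tr (A_mx m.+2 r v + B3_mx m.+2 v *m K) = b * K 0 0.
Proof.
rewrite -raddfB /= opprD addrACA subrr add0r -mulmxBl mxtrace_mulC.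
rewrite /mxtrace big_ord1 mxE big_ord_recl big1 => [|i _].
  by rewrite !mxE /= addr0 subr0 mulrC.
by rewrite !mxE /= subrr mulr0.
Qed.

(** Subtracting from r clears the first column except for its last entry; the minor left by deleting
    that column and the last row is lower triangular with diagonal -v. *)
Lemma det_S3 (R : realType) (m : nat) (r v : R) (K : 'M[R]_(1, m.+1)) :
  \det (r%:M - (A_mx m.+1 r v + B3_mx m.+1 v *m K)) = - K 0 0 * v ^+ m.+1.
Proof.
set M := _ - _.
have ME i j : M i j = r *+ (i == j :> nat) - ((if (i == 0%N :> nat) && (j == 0%N :> nat)
    then r else if (j == i.+1 :> nat) then v else 0) +
    (if i == m :> nat then v else 0) * K 0 j).
  by rewrite !mxE big_ord1 !mxE eqSS.
clearbody M.
rewrite (expand_det_col _ ord0) (bigD1 ord_max) //= big1 => [|i i_max]; last first.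
  have /negbTE i_neq_m : i != m :> nat by rewrite -val_eqE in i_max.
  rewrite ME i_neq_m /= mul0r addr0.
  have [->|i0] := eqVneq i 0; first by rewrite /= subrr mul0r.
  by rewrite (negbTE (_ : i != 0%N :> nat)) /= ?subrr ?mul0r.
rewrite /cofactor det_trig => [|]; last first.
  apply/is_trig_mxP => i j i_lt_j; rewrite !mxE ME lift0 lift_max.
  rewrite (ltn_eqF (ltn_ord i)) andbF eqSS (gtn_eqF i_lt_j).
  by rewrite (ltn_eqF (ltnW i_lt_j : (i < j.+1)%N)) /= mul0r addr0 subr0.
rewrite (eq_bigr (fun=> - v)) => [|i _]; last first.
  rewrite !mxE ME lift0 lift_max (ltn_eqF (ltn_ord i)) andbF eqxx.
  by rewrite (ltn_eqF (ltnSn i)) mul0r addr0 sub0r.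
rewrite prodr_const card_ord ME eqxx /= andbT addn0 addr0.
rewrite -exprMn mulrNN mul1r eqxx exprS.
(* For m = 0 the last row is also the first, and r cancels there too. *)
have -> : r *+ (m == 0) = if m == 0 then r else 0 by case: (m == 0).
by rewrite opprD addNKr; ring.
Qed.

Lemma double_le_expn2 (n : nat) : (2 <= n -> n.*2 <= 2 ^ n)%N.
Proof.
case: n => // n; rewrite expnS mul2n leq_double => _; exact: ltn_expl.
Qed.

Lemma not_co_stabilizable_static_S3_S4 (R : realType) (n : nat) (r v b : R) :
  (2 <= n)%N -> 1 < r -> 0 < v -> (2 * v / (r - 1)) ^+ n < b ->
  ~ co_stabilizable_static (LTISystem (A_mx n r v) (B3_mx n v))
      (LTISystem (A_mx n r v) (B4_mx n v b)).
Proof.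
case: n => [|[|m]] // n_ge2 r_gt1 v_gt0 b_gt [K [K3 K4]].
have r1_gt0 : 0 < r - 1 by rewrite subr_gt0.
set q := 2 * v / (r - 1) in b_gt.
have q_ge0 : 0 <= q by rewrite divr_ge0 ?mulr_ge0 ?ltW.
have b_gt0 : 0 < b := le_lt_trans (exprn_ge0 _ q_ge0) b_gt.
have k_lb : (r - 1) ^+ m.+2 <= `|K 0 0| * v ^+ m.+2.
  rewrite -[v]gtr0_norm // -normrX -normrM -normrN -mulNr -(det_S3 r).
  exact: norm_det_sub_ge K3 _ (ltW r_gt1).
have k_ub : b * `|K 0 0| <= 2 ^+ m.+2.
  rewrite -{1}(gtr0_norm b_gt0) -normrM -(mxtrace_S4_sub_S3 r v).
  apply: le_trans (ler_normB _ _) _.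
  apply: le_trans (lerD (norm_mxtrace_le K4) (norm_mxtrace_le K3)) _.
  by rewrite -natrD addnn -natrX ler_nat double_le_expn2.
have k_gt0 : 0 < `|K 0 0|.
  rewrite -(pmulr_lgt0 _ (exprn_gt0 m.+2 v_gt0)).
  exact: lt_le_trans (exprn_gt0 _ r1_gt0) k_lb.
have: q ^+ m.+2 * `|K 0 0| < 2 ^+ m.+2.
  by apply: lt_le_trans k_ub; rewrite ltr_pM2r.
(* After unfolding [q], the reverse inequality is [k_lb] multiplied by 2^n. *)
apply/negP; rewrite -leNgt /q expr_div_n exprMn mulrAC ler_pdivlMr ?exprn_gt0 //.
by rewrite -[leRHS]mulrA ler_wpM2l ?exprn_ge0 // mulrC.
Qed.

(** * Closed-loop eigenvalues under the shift-register controller *)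

Section Controller.

Variables (R : realType) (m p : nat) (r v : R) (alpha kappa : {poly R}).

(* With n = m + 2, the dynamic part is a shift register whose left eigenvectors
   are geometric in 1/z, so [ctrl_G] and the first two entries of [ctrl_K]
   hold the coefficients of alpha (fed by x_1) and kappa (fed by x_2). *)
Definition ctrl_K : 'M[R]_(1, m.+2) := \row_j
  if j == 0%N :> nat then alpha`_0
  else if j == 1%N :> nat then kappa`_0
  else - (r / v) ^+ (m.+2 - j).

Definition ctrl_H : 'M[R]_(1, p) := \row_k (k == 0%N :> nat)%:R.

Definition ctrl_G : 'M[R]_(p, m.+2) := \matrix_(k, j)
  if j == 0%N :> nat then alpha`_k.+1
  else if j == 1%N :> nat then kappa`_k.+1
  else 0.

Definition ctrl_F : 'M[R]_p := \matrix_(k, l) (l == k.+1 :> nat)%:R.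

Variables (b : R) (z : R[i]).

Local Notation toC := (real_complex R).
Local Notation f := (map_mx toC).

Hypotheses (r_gt0 : 0 < r) (v_gt0 : 0 < v) (b_ge0 : 0 <= b) (z_neq0 : z != 0).
Hypotheses (size_alpha : (size alpha <= p.+1)%N).
Hypotheses (size_kappa : (size kappa <= p.+1)%N).

Hypothesis alpha_kappa :
  v *: ('X * alpha) + (1 - r *: 'X) * kappa + ((r / v) ^+ m.+1)%:P = 0.

Section LeftEigenvector.

Variables (y : 'rV[R[i]]_m.+2) (w : 'rV[R[i]]_p).

(** Every feedback term enters the left eigenvector equations through this scalar. *)
Let s := (y *m f (B4_mx m.+2 v b)) 0 0.

Let Y j := y 0 (inord j).

Lemma s_last : s = Y 0 * toC b + Y m.+1 * toC v.
Proof.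
rewrite /s mxE big_ord_recl big_ord_recr /= big1 => [|i _].
  have -> : lift ord0 (ord_max : 'I_m.+1) = inord m.+1.
    by apply: val_inj; rewrite /= inordK.
  have -> : (ord0 : 'I_m.+2) = inord 0 by apply: val_inj; rewrite /= inordK.
  by rewrite !mxE !inordK //= eqxx add0r.
by rewrite !mxE /= /bump /= add1n !eqSS (ltn_eqF (ltn_ord i)) rmorph0 mulr0.
Qed.

Lemma mul_A_col0 : (y *m f (A_mx m.+2 r v)) 0 (inord 0) = Y 0 * toC r.
Proof.
rewrite mxE (bigD1 (inord 0)) //= big1 => [|i i_neq0].
  by rewrite !mxE !inordK // addr0.
rewrite !mxE inordK // andbT ifN ?rmorph0 ?mulr0 //.
by apply: contra i_neq0 => /eqP <-; rewrite inord_val.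
Qed.

Lemma mul_A_colS (j : nat) : (j < m.+1)%N ->
  (y *m f (A_mx m.+2 r v)) 0 (inord j.+1) = Y j * toC v.
Proof.
move=> j_lt; rewrite mxE (bigD1 (inord j)) //= big1 => [|i i_neq].
  by rewrite !mxE !inordK ?ltnS // 1?ltnW // andbF eqxx addr0.
rewrite !mxE inordK ?ltnS // andbF eqSS ifN ?rmorph0 ?mulr0 //.
by apply: contra i_neq => /eqP ->; rewrite inord_val.
Qed.

Hypothesis wE : y *m f (B4_mx m.+2 v b) *m f ctrl_H + w *m f ctrl_F = z *: w.

(** Read by columns, [wE] says z w_0 = s and z w_(k+1) = w_k. *)
Lemma memory_state (k : 'I_p) : w 0 k = s * z^-1 ^+ k.+1.
Proof.
case: k => k k_lt; elim: k k_lt => [|k IHk] k_lt.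
  have /rowP/(_ (Ordinal k_lt)) := wE.
  rewrite !mxE big_ord1 -/s !mxE /= rmorph1 mulr1 big1 => [|i _].
    by rewrite addr0 expr1 => ->; rewrite mulrC mulKf.
  by rewrite !mxE rmorph0 mulr0.
have /rowP/(_ (Ordinal k_lt)) := wE.
rewrite !mxE big_ord1 !mxE /= rmorph0 mulr0 add0r.
rewrite (bigD1 (Ordinal (ltnW k_lt))) //= big1 => [|i i_neq].
  rewrite !mxE eqxx rmorph1 mulr1 addr0 IHk => /esym/(canRL (mulKf z_neq0)) ->.
  by rewrite mulrCA -!exprS.
rewrite !mxE eqSS eq_sym /= (negbTE (_ : i != k :> nat)) ?rmorph0 ?mulr0 //.
Qed.

(** The constant coefficient acts directly through [ctrl_K]; coefficient k + 1 acts through register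
    k, whose weight carries k + 1 factors 1/z. *)
Lemma feedback_horner (q : {poly R}) : (size q <= p.+1)%N ->
  s * toC q`_0 + \sum_k w 0 k * toC q`_k.+1 = s * (map_poly toC q).[z^-1].
Proof.
move=> size_q.
rewrite (@horner_coef_wide _ p.+1) ?size_map_poly // big_ord_recl mulrDr.
rewrite expr0 mulr1 coef_map mulr_sumr; congr (_ + _).
apply: eq_bigr => k _; rewrite memory_state coef_map lift0 /=.
by rewrite -mulrA [toC _ * _]mulrC.
Qed.

Hypothesis yE : y *m f (A_mx m.+2 r v + B4_mx m.+2 v b *m ctrl_K) +
  w *m f ctrl_G = z *: y.

Lemma yE_col j : (y *m f (A_mx m.+2 r v)) 0 j +
  (s * toC (ctrl_K 0 j) + \sum_k w 0 k * toC (ctrl_G k j)) = z * y 0 j.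
Proof.
have /rowP/(_ j) := yE; rewrite map_mxD map_mxM mulmxDr mulmxA !mxE => <-.
rewrite addrA big_ord1 -/s; congr (_ + s * _ + _); first by rewrite !mxE.
by apply: eq_bigr => k _; rewrite !mxE.
Qed.

Let al := (map_poly toC alpha).[z^-1].
Let ka := (map_poly toC kappa).[z^-1].

Lemma Y0E : z * Y 0 = toC r * Y 0 + s * al.
Proof.
rewrite -yE_col mul_A_col0 -feedback_horner // mulrC; congr (_ + (_ + _)).
  by rewrite !mxE inordK.
by apply: eq_bigr => k _; rewrite !mxE inordK.
Qed.

Lemma Y1E : z * Y 1 = toC v * Y 0 + s * ka.
Proof.
rewrite -yE_col mul_A_colS // -feedback_horner // mulrC; congr (_ + (_ + _)).
  by rewrite !mxE inordK.
by apply: eq_bigr => k _; rewrite !mxE inordK.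
Qed.

Lemma YSE j : (0 < j < m.+1)%N ->
  z * Y j.+1 = toC v * Y j - s * toC ((r / v) ^+ (m.+2 - j.+1)).
Proof.
case/andP=> j_gt0 j_lt; rewrite -yE_col mul_A_colS // mulrC.
rewrite big1 ?addr0 => [|k _].
  rewrite !mxE inordK // eqSS (gtn_eqF j_gt0).
  by rewrite rmorphN mulrN.
by rewrite !mxE inordK // eqSS (gtn_eqF j_gt0) rmorph0 mulr0.
Qed.

Lemma alpha_kappa_horner :
  toC v * al + (z - toC r) * ka + z * toC ((r / v) ^+ m.+1) = 0.
Proof.
have /(congr1 (fun q => z * (map_poly toC q).[z^-1])) := alpha_kappa.
rewrite !rmorphD !rmorphM rmorphB /= !map_polyZ /= rmorphM /= rmorph1.
rewrite !map_polyX map_polyC !hornerE /= -/al -/ka rmorph0 horner0 mulr0 => E.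
by rewrite -[RHS]E; field.
Qed.

(* The left-hand side q_j satisfies [q_(j+1) = (v / z) q_j], and [alpha_kappa]
   says that q_0 vanishes. *)
Lemma chain_eq0 j : (j < m.+1)%N ->
  (z - toC r) * Y j.+1 + s * toC ((r / v) ^+ (m.+1 - j)) = 0.
Proof.
have Cv_neq0 : toC v != 0 by rewrite fmorph_eq0 gt_eqF.
elim: j => [|j IHj] j_lt; apply: (mulfI z_neq0).
  rewrite subn0 mulr0 mulrDr [z * (_ * _)]mulrCA Y1E mulrDr.
  rewrite [_ * (toC v * _)]mulrCA mulrBl Y0E [toC r * _ + _]addrC addrK.
  rewrite -[RHS](mulr0 s) -alpha_kappa_horner; ring.
(* The static gains are chosen for this step: -(z - r) + z = r, and r (r/v)^(m-j) = v
   (r/v)^(m+1-j). *)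
rewrite mulr0 mulrDr [z * (_ * _)]mulrCA YSE //.
rewrite -[RHS](mulr0 (toC v)) -(IHj (ltnW j_lt)) (@subSn j m (ltnW j_lt)).
rewrite exprS !rmorphM /= fmorphV.
by field; exact: Cv_neq0.
Qed.

(** The end of the chain, with v Y_(m+1) = s - b Y_0 from [s_last], reads z s = b (z - r) Y_0, and
    (z - r) Y_0 = s al by [Y0E]. *)
Lemma control_eq : z * s = toC b * s * al.
Proof.
have Cv_neq0 : toC v != 0 by rewrite fmorph_eq0 gt_eqF.
have := chain_eq0 (ltnSn m); rewrite subSnn expr1.
move/(congr1 ( *%R (toC v))); rewrite mulr0 rmorphM /= fmorphV => E.
have {}E : (z - toC r) * (s - Y 0 * toC b) + s * toC r = 0.
  by rewrite -[RHS]E {1}s_last; field; exact: Cv_neq0.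
have salE : s * al = z * Y 0 - toC r * Y 0 by rewrite Y0E addrC addKr.
apply/eqP; rewrite -subr_eq0 -mulrA salE -[X in _ == X]E; apply/eqP; ring.
Qed.

(** This is the Hautus test for reachability: if s = 0, the memory part vanishes and y is a left
    eigenvector of A orthogonal to B. *)
Lemma control_neq0 : row_mx y w != 0 -> s != 0.
Proof.
apply: contra_neq => s0.
have -> : w = 0 by apply/rowP => k; rewrite memory_state s0 mul0r mxE.
suff Y0 j : (j < m.+2)%N -> Y j = 0.
  suff -> : y = 0 by rewrite row_mx0.
  by apply/rowP => j; rewrite mxE -[RHS](Y0 j) // /Y inord_val.
have YE i : (i < m.+2)%N -> z ^+ i * Y i = toC v ^+ i * Y 0.
  elim: i => [|[|i] IHi] i_lt; first by rewrite !expr0.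
    by rewrite !expr1 Y1E s0 mul0r addr0.
  rewrite exprSr -mulrA YSE // s0 mul0r subr0 mulrCA IHi 1?ltnW //.
  by rewrite mulrA -exprS.
suff Y00 : Y 0 = 0.
  move=> /YE /eqP; rewrite Y00 mulr0 mulf_eq0 expf_eq0 (negbTE z_neq0) andbF /=.
  by move/eqP.
(* Either Y_0 = 0 or z = r; in the latter case r^(m+1) s = (r^(m+1) b + v^(m+2)) Y_0, whose factor
   is positive because b >= 0. *)
have := Y0E; rewrite s0 mul0r addr0 => /eqP; rewrite -subr_eq0 -mulrBl mulf_eq0.
case/orP => [|/eqP //]; rewrite subr_eq0 => /eqP zr.
have := s_last; rewrite s0 => /(congr1 ( *%R (z ^+ m.+1))).
rewrite mulr0 mulrDr [X in _ + X]mulrA YE // zr => /esym/eqP.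
have -> : toC r ^+ m.+1 * (Y 0 * toC b) + toC v ^+ m.+1 * Y 0 * toC v =
    toC (r ^+ m.+1 * b + v ^+ m.+2) * Y 0.
  rewrite rmorphD rmorphM !rmorphXn /= [toC v ^+ m.+2]exprSr; ring.
rewrite mulf_eq0 fmorph_eq0 gt_eqF => [/eqP //|].
by rewrite ltr_wpDl ?exprn_gt0 // mulr_ge0 // exprn_ge0 // ltW.
Qed.

End LeftEigenvector.

Lemma eigenvalue_dynamic_closed_loop :
  eigenvalue (f (dynamic_closed_loop
    (LTISystem (A_mx m.+2 r v) (B4_mx m.+2 v b))
    ctrl_K ctrl_H ctrl_G ctrl_F)) z ->
  z = toC b * (map_poly toC alpha).[z^-1].
Proof.
case/eigenvalueP => x; rewrite -[x]hsubmxK; move: (lsubmx x) (rsubmx x) => y w.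
rewrite map_block_mx mul_row_block scale_row_mx => /eq_row_mx [yE wE] x_neq0.
rewrite map_mxM mulmxA in wE.
have s_neq0 := control_neq0 wE yE x_neq0.
by apply: (mulIf s_neq0); rewrite mulrAC; apply: control_eq wE yE.
Qed.

End Controller.

(** * Existence of the polynomials alpha and kappa *)

Lemma bernoulli_le (R : numDomainType) (d : R) (N : nat) :
  0 <= d -> 1 + d *+ N <= (1 + d) ^+ N.
Proof.
move=> d_ge0; elim: N => [|N IHN]; first by rewrite mulr0n addr0.
rewrite exprS mulrDl mul1r mulrSr addrA lerD //.
apply: ler_peMr => //; apply: le_trans IHN.
by rewrite lerDl mulrn_wge0.
Qed.

(** The power is 1 at a = 0 and, by Bernoulli's inequality, at least c at a = 1/2 for large N; the
    intermediate value theorem applies. *)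
Lemma exists_root_le_half (R : realType) (r c : R) : 0 < r -> 1 <= c ->
  exists2 a : R, 0 <= a <= 2^-1 & exists N, (1 + a / r) ^+ N = c.
Proof.
move=> r_gt0 c_ge1; set d := 2^-1 / r.
have d_gt0 : 0 < d by rewrite divr_gt0 ?invr_gt0.
pose N := Num.bound (c / d).
have cN : c <= (1 + d) ^+ N.
  apply: le_trans (bernoulli_le N (ltW d_gt0)).
  rewrite -mulr_natl ler_wpDl // -ler_pdivrMr // ltW // archi_boundP //.
  by rewrite divr_ge0 ?(ltW d_gt0) // (le_trans ler01).
pose P : {poly R} := (1 + r^-1 *: 'X) ^+ N - c%:P.
have PE x : P.[x] = (1 + x / r) ^+ N - c by rewrite !hornerE [r^-1 * x]mulrC.
have [] := @poly_ivt _ P 0 (2^-1).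
- by rewrite invr_ge0.
- by rewrite !PE mul0r addr0 expr1n subr_le0 c_ge1 subr_ge0.
move=> a a_itv; rewrite rootE PE subr_eq0 => /eqP aE.
by exists a => //; exists N.
Qed.

Lemma size_factor_XsubC (F : idomainType) (q : {poly F}) (c : F) (N : nat) :
  (size (q * ('X - c%:P))%R <= N.+1)%N -> (size q <= N)%N.
Proof.
have [->|q_neq0] := eqVneq q 0; first by rewrite size_poly0.
by rewrite size_Mmonic ?monicXsubC // size_XsubC addn2.
Qed.

Lemma exists_controller_polys (R : realType) (m : nat) (r v b : R) :
  0 < r -> 0 < v -> 0 < b ->
  exists (a : R) (N : nat) (alpha kappa : {poly R}),
  [/\ 0 <= a <= 2^-1, (size alpha <= N.+1)%N /\ (size kappa <= N.+1)%N,
    b *: ('X * alpha) = 1 - (1 + a *: 'X) ^+ N &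
    v *: ('X * alpha) + (1 - r *: 'X) * kappa + ((r / v) ^+ m.+1)%:P = 0].
Proof.
move=> r_gt0 v_gt0 b_gt0.
have [r_neq0 v_neq0 b_neq0] : [/\ r != 0, v != 0 & b != 0].
  by split; rewrite gt_eqF.
(* At X = 1/r the second identity forces b alpha(1/r) / r = -g, so the first one demands (1 + a/r)^N
   = 1 + g. *)
pose g := b * r ^+ m.+1 / v ^+ m.+2.
have g_ge0 : 0 <= g.
  by apply/ltW/divr_gt0; [apply: mulr_gt0 => //|]; apply: exprn_gt0.
have [|a a_itv [N aE]] := @exists_root_le_half R r (1 + g) r_gt0.
  by rewrite lerDl.
(* Dividing by X gives b alpha, of degree below N. *)
have /factor_theorem[T TE] : root (1 - (1 + a *: 'X) ^+ N) 0.
  by rewrite rootE !hornerE expr1n subrr.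
have size_T : (size T <= N)%N.
  apply: (@size_factor_XsubC _ _ 0); rewrite -TE.
  apply: leq_trans (size_polyD _ _) _; rewrite size_polyN size_poly1 geq_max /=.
  apply: leq_trans (size_poly_exp_leq _ _) _; rewrite ltnS.
  have s2 : (size (1 + a *: 'X)%R <= 2)%N.
    apply: leq_trans (size_polyD _ _) _; rewrite size_poly1 geq_max /=.
    by rewrite (leq_trans (size_scale_leq _ _)) ?size_polyX.
  by rewrite -{2}[N]mul1n leq_mul2r -subn1 leq_subLR s2 orbT.
pose alpha := b^-1 *: T.
have size_alpha : (size alpha <= N)%N by apply: leq_trans (size_scale_leq _ _) _.
have bE : b *: ('X * alpha) = 1 - (1 + a *: 'X) ^+ N.
  by rewrite /alpha -scalerAr scalerA divff // scale1r TE subr0 mulrC.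
clearbody alpha.
(* The choice of a makes this sum divisible by X - 1/r; since 1 - r X = -r (X - 1/r), kappa is Q /
   r. *)
have /factor_theorem[Q QE] :
    root (v *: ('X * alpha) + ((r / v) ^+ m.+1)%:P) r^-1.
  have E : r^-1 * alpha.[r^-1] = - g / b.
    have /(congr1 (fun q => q.[r^-1])) := bE.
    rewrite hornerZ hornerM hornerX !hornerE aE => E.
    by apply: (mulfI b_neq0); rewrite mulrA E; field.
  rewrite rootE hornerD hornerZ hornerM hornerX hornerC E /g expr_div_n.
  rewrite [v ^+ m.+2]exprS; apply/eqP; field.
  by rewrite b_neq0 v_neq0 expf_neq0.
have size_Q : (size Q <= N)%N.
  apply: (@size_factor_XsubC _ _ r^-1); rewrite -QE.
  apply: leq_trans (size_polyD _ _) _.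
  rewrite geq_max (leq_trans (size_polyC_leq1 _)) // andbT.
  apply: leq_trans (size_scale_leq _ _) _.
  apply: leq_trans (size_polyMleq _ _) _.
  by rewrite size_polyX.
exists a, N, alpha, (r^-1 *: Q); split => //.
  by split; rewrite ?(leq_trans (size_scale_leq _ _)) // ltnW.
rewrite addrAC QE.
have -> : 1 - r *: 'X = - r *: ('X - r^-1%:P) :> {poly R}.
  rewrite -!mul_polyC mulrBr -polyCM mulNr divff // !polyCN polyC1; ring.
rewrite -scalerAl -scalerAr scalerA mulNr divff // scaleN1r mulrC subrr //.
Qed.

(** * Stabilization of both systems by one dynamic controller *)

(** Thus the eigenvalue equation, valid for all b >= 0, serves both systems. *)
Lemma B3_mxE (R : realType) (m : nat) (v : R) : B3_mx m.+2 v = B4_mx m.+2 v 0.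
Proof.
by apply/colP => -[[|i] i_lt]; rewrite !mxE.
Qed.

Lemma co_stabilizable_dynamic_S3_S4 (R : realType) (n : nat) (r v b : R) :
  (2 <= n)%N -> 0 < r -> 0 < v -> 0 < b ->
  co_stabilizable_dynamic (LTISystem (A_mx n r v) (B3_mx n v))
    (LTISystem (A_mx n r v) (B4_mx n v b)).
Proof.
case: n => [|[|m]] // _ r_gt0 v_gt0 b_gt0.
have [a [N [alpha [kappa]]]] := exists_controller_polys m r_gt0 v_gt0 b_gt0.
case=> /andP[a_ge0 a_le] [size_alpha size_kappa] alphaE kappaE.
exists N, (ctrl_K m r v alpha kappa), (ctrl_H R N), (ctrl_G m N alpha kappa),
  (ctrl_F R N).
rewrite B3_mxE.
have half_lt1 : 2^-1 < 1 :> R by rewrite invf_lt1 // ltr1n.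
split; (apply: le_lt_trans (le_lt_trans a_le half_lt1);
  apply: spectral_radius_le => // z z_eig).
  have [->|z_neq0] := eqVneq z 0; first by rewrite normr0 ler0c.
  have zE := eigenvalue_dynamic_closed_loop r_gt0 v_gt0 (lexx 0) z_neq0
    size_alpha size_kappa kappaE z_eig.
  by rewrite zE rmorph0 mul0r normr0 ler0c.
have [->|z_neq0] := eqVneq z 0; first by rewrite normr0 ler0c.
have zE := eigenvalue_dynamic_closed_loop r_gt0 v_gt0 (ltW b_gt0) z_neq0
  size_alpha size_kappa kappaE z_eig.
(* Evaluated at 1/z, the left side is z / z = 1 by [zE], so (1 + a/z)^N = 0 and z = -a. *)
have /(congr1 (fun q => (map_poly (real_complex R) q).[z^-1])) := alphaE.
rewrite map_polyZ rmorphB rmorphXn rmorphD !rmorphM /= !rmorph1 map_polyZ /=.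
rewrite !map_polyX !hornerE /= mulrAC -zE divff // => /eqP.
rewrite -[X in X == _]subr0 (inj_eq (addrI _)) eqr_opp eq_sym expf_eq0.
case/andP=> _; rewrite addrC addr_eq0 => /eqP /(canRL (divfK z_neq0)).
rewrite mulN1r => aE; have -> : z = - real_complex R a by rewrite aE opprK.
by rewrite normrN normr_normc /= expr0n addr0 sqrtr_sqr ger0_norm.
Qed.

Theorem theorem3 (R : realType) (n : nat) (r v b : R)
    (hn : (2 <= n)%N) (hr : 1 < r) (hv0 : 0 < v) (hv : v < (r - 1) / 2)
    (hb : (2 * v / (r - 1)) ^+ n < b) :
  let S3 := LTISystem (A_mx n r v) (B3_mx n v) in
  let S4 := LTISystem (A_mx n r v) (B4_mx n v b) in
  ~ co_stabilizable_static S3 S4 /\ co_stabilizable_dynamic S3 S4.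
Proof.
split; first exact: not_co_stabilizable_static_S3_S4.
apply: co_stabilizable_dynamic_S3_S4 => //; first exact: lt_trans hr.
apply: le_lt_trans hb; apply: exprn_ge0.
by rewrite divr_ge0 ?mulr_ge0 ?subr_ge0 ?ltW.
Qed.
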